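(* Let $L_1,L_2\ge1$ and consider two groups of moduli $m_{i,k}=m^{(i)}\Gamma_{i,k}$ ($i=1,2$, $1\le k\le L_i$), where $m^{(i)}\ge1$ are integers and, for each $i$, the integers $\Gamma_{i,1},\dots,\Gamma_{i,L_i}\ge1$ are pairwise co-prime. Let $\eta_i=\mathrm{lcm}(m_{i,1},\dots,m_{i,L_i})$, assume $\eta_1<\eta_2$, let $m=\gcd(\eta_1,\eta_2)$, $\Gamma_i=\eta_i/m$, and assume $\Gamma_1>1$. Let $1\le j\le K+1$ (with $\sigma_j,K,\ddot n_{2,j},\ddot n_{1,j}$ computed from $\Gamma_1,\Gamma_2$ as in the context) and put $X=\min\big(\eta_2(1+\ddot n_{2,j}),\,\eta_1(1+\ddot n_{1,j})\big)$. Let $\tau_1,\tau_2\ge0$ be reals with $$\tau_1<\frac{m^{(1)}}{4},\qquad \tau_2<\frac{m^{(2)}}{4},\qquad \tau_1+\tau_2<\frac{m\sigma_j}{2}.$$ Then there exists a map $\Phi$ from tuples $(\tilde r_{i,k})_{i,k}$ of integers to tuples of integers such that for every integer $N$ with $0\le N<X$ and every tuple of integers $\tilde r_{i,k}$ with $0\le\tilde r_{i,k}<m_{i,k}$ and $|\tilde r_{i,k}-|N|_{m_{i,k}}|\le\tau_i$ for all $i,k$, one has $\Phi((\tilde r_{i,k})_{i,k})=(\lfloor N/m_{i,k}\rfloor)_{i,k}$; i.e., all folding integers of $N$ modulo the $m_{i,k}$ are accurately determined by the erroneous remainders.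
   Context: $|a|_b$ is the remainder of the integer $a$ modulo the positive integer $b$. Euclidean sequence for co-prime $1<\Gamma_1<\Gamma_2$: $\sigma_{-1}=\Gamma_2$, $\sigma_0=\Gamma_1$, $\sigma_i=|\sigma_{i-2}|_{\sigma_{i-1}}$ for $i\ge1$; $K\ge0$ is the index with $\sigma_K>1$, $\sigma_{K+1}=1$. For $1\le n<\Gamma_1$, $S_{2,n}=\{|t\Gamma_2|_{\Gamma_1}:0\le t\le n\}$ and $d_{2,n}$ is the minimum distance between distinct elements of $S_{2,n}$; for $1\le n<\Gamma_2$, $S_{1,n}=\{|t\Gamma_1|_{\Gamma_2}:0\le t\le n\}$ and $d_{1,n}$ likewise. $\ddot n_{2,j}=\max\{n:1\le n<\Gamma_1,\ d_{2,n}\ge\sigma_j\}$, $\ddot n_{1,j}=\max\{n:1\le n<\Gamma_2,\ d_{1,n}\ge\sigma_j\}$. The groups may overlap (a modulus may appear in both). *)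

(* Defs.v *)
From HB Require Import structures.
From mathcomp Require Import all_boot all_order all_algebra.
Set Implicit Arguments. Unset Strict Implicit. Unset Printing Implicit Defensive.

(* Euclidean sequence for (G1, G2): euclid_pair i = (sigma_{i-1}, sigma_i). *)
Fixpoint euclid_pair (G1 G2 : nat) (i : nat) : nat * nat :=
  match i with
  | 0 => (G2, G1)
  | i'.+1 => let p := euclid_pair G1 G2 i' in (p.2, p.1 %% p.2)
  end.

(* sigma G1 G2 i = sigma_i for i >= 0 (sigma_0 = G1, sigma_{-1} = G2). *)
Definition sigma (G1 G2 : nat) (i : nat) : nat := (euclid_pair G1 G2 i).2.

Definition ndist (x y : nat) : nat := maxn x y - minn x y.

(* d_n for S_n = { |t a|_b : 0 <= t <= n }: minimum distance between distinct
   elements.  All elements lie in [0, b), so b is a neutral upper bound. *)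
Definition mindist (a b n : nat) : nat :=
  \big[minn/b]_(t1 < n.+1)
    \big[minn/b]_(t2 < n.+1 | (t1 * a) %% b != (t2 * a) %% b)
      ndist ((t1 * a) %% b) ((t2 * a) %% b).

(* nddot a b s = max { n : 1 <= n < b, mindist a b n >= s }.
   n_ddot_{2,j} = nddot G2 G1 (sigma_j), n_ddot_{1,j} = nddot G1 G2 (sigma_j). *)
Definition nddot (a b s : nat) : nat :=
  \max_(1 <= n < b | s <= mindist a b n) n.

Definition lcm_moduli (L : nat) (mi : nat) (G : 'I_L -> nat) : nat :=
  \big[lcmn/1]_(k < L) (mi * G k).

(* Main.v *)
(* Two numbers compatible with the same erroneous remainders differ, in group i,
   by A_i * eta_i + e_i with |e_i| <= 2 tau_i: all the error differences of a
   group agree modulo m^(i) and are smaller than m^(i) / 2, hence coincide.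
   Therefore |A_1 Gamma_1 - A_2 Gamma_2| < sigma_j, while the range of N forces
   |A_i| to be at most the corresponding n_ddot.  If A_1 and A_2 were not both 0,
   this small difference would be the remainder of A_2 Gamma_2 modulo Gamma_1 or
   of A_1 Gamma_1 modulo Gamma_2, against the minimum distance bound.  So the
   folding integers are unique, and Phi is a search over the finitely many N. *)
Require Import Defs.
From HB Require Import structures.
From mathcomp Require Import all_boot all_order all_algebra.
From mathcomp Require Import zify lra.
Import Order.TTheory GRing.Theory Num.Theory.
Local Open Scope ring_scope.

Lemma sigma_leq (G1 G2 i : nat) : (0 < G1)%N -> (sigma G1 G2 i <= G1)%N.
Proof.
move=> G1_gt0; case: i => [//|i].
(* Bounding both components makes the induction go through; it starts at index 1 because the first
   component at index 0 is [G2]. *)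
suff /andP[] : ((euclid_pair G1 G2 i.+1).1 <= G1)%N &&
               ((euclid_pair G1 G2 i.+1).2 <= G1)%N by [].
elim: i => [|i]; first by rewrite /= leqnn ltnW ?ltn_pmod.
set p := euclid_pair _ _ i.+1 => /andP[h1 h2].
rewrite [euclid_pair _ _ _]/= -/p h2 /=.
exact: leq_trans (leq_mod _ _) h1.
Qed.

Lemma bigminn_leq (I : finType) (P : pred I) (F : I -> nat) (b : nat) (k : I) :
  P k -> (\big[minn/b]_(i | P i) F i <= F k)%N.
Proof.
move=> Pk; have := mem_index_enum k; elim: (index_enum I) => // i s IH.
rewrite inE big_cons => /predU1P[<-|/IH h]; first by rewrite Pk geq_minl.
by case: ifP => // _; apply: leq_trans h; apply: geq_minr.
Qed.

(** The index 0 contributes the residue 0, so a nonzero residue is itself one of the distances in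
    the minimum. *)
Lemma mindist_leq_mod (a b n t : nat) :
  (t <= n)%N -> ((t * a) %% b != 0)%N -> (mindist a b n <= (t * a) %% b)%N.
Proof.
move=> tn t0; pose t' := Ordinal (tn : (t < n.+1)%N).
apply: (leq_trans (bigminn_leq _ _ _ _ ord0 isT)).
apply: (leq_trans (bigminn_leq _ _ _ _ t' _)); first by rewrite /= mul0n mod0n eq_sym.
by rewrite /ndist /= mul0n mod0n max0n min0n subn0.
Qed.

(** An empty maximum is 0, so positivity means that the maximum is attained by an admissible
    index. *)
Lemma nddot_mindist (a b s : nat) :
  (0 < nddot a b s)%N -> (s <= mindist a b (nddot a b s))%N.
Proof.
suff: nddot a b s = 0%N \/ (s <= mindist a b (nddot a b s))%N by case=> [->|].
rewrite /nddot; elim/big_rec: _ => [|i x si IH]; first by left.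
by right; case: (leqP i x) => // xi; case: IH => // x0; move: xi; rewrite x0; case: i si.
Qed.

Lemma nddot_leq_mod (a b s t : nat) :
  (t <= nddot a b s)%N -> ((t * a) %% b != 0)%N -> (s <= (t * a) %% b)%N.
Proof.
move=> tn t0; apply: leq_trans (mindist_leq_mod _ _ _ _ tn t0).
by apply: nddot_mindist; case: t tn t0 => [|t] tn; [rewrite mul0n mod0n | lia].
Qed.

(** A positive difference below [s <= b] would be the remainder of [t * a] modulo [b], against the
    distance bound. *)
Lemma nddot_leq_diff (a b s t u : nat) :
  (t <= nddot a b s)%N -> (s <= b)%N -> (u * b < t * a)%N ->
  (s <= t * a - u * b)%N.
Proof.
move=> tn sb ut; rewrite leqNgt; apply/negP => lt_s.
have E : ((t * a) %% b = t * a - u * b)%N.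
  by rewrite -{1}(subnKC (ltnW ut)) modnMDl modn_small //; apply: leq_trans sb.
have nz : ((t * a) %% b != 0)%N by rewrite E; lia.
by have := nddot_leq_mod _ _ _ _ tn nz; rewrite E; lia.
Qed.

Lemma nddot_ltn (a b s : nat) : (0 < b)%N -> (nddot a b s < b)%N.
Proof.
move=> b0; rewrite /nddot big_seq_cond; apply: (big_ind (fun n => n < b)%N) => //.
  by move=> x y; rewrite gtn_max => -> ->.
by move=> i; rewrite mem_index_iota => /andP[/andP[]].
Qed.

Lemma small_combination_eq0 (a b s : nat) (x y : int) :
  (0 < a)%N -> coprime a b -> (s <= a)%N -> (s <= b)%N ->
  (`|x| <= nddot a b s)%N -> (`|y| <= nddot b a s)%N ->
  `|x * a%:Z - y * b%:Z| < s%:Z -> x = 0 /\ y = 0.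
Proof.
move=> a0 cab sa sb.
wlog x0 : x y / 0 <= x => [hw|].
  case: (leP 0 x) => [x0|x0] hx hy h; first exact: hw.
  have [] := hw (- x) (- y); rewrite ?abszN //; lia.
case: x x0 => [x|//] _ /= xn yn.
(* For negative [y] the two terms add up to at least [b >= s]. *)
case: y yn => [y|y] /= yn; last by move=> h; exfalso; rewrite NegzE in h; nia.
case: (ltngtP (x * a) (y * b)) => h.
- by have := nddot_leq_diff _ _ _ _ _ yn sa h; lia.
- by have := nddot_leq_diff _ _ _ _ _ xn sb h; lia.
(* In the case of equality coprimality gives [a %| y], and [y < a] then forces [y = 0]. *)
- have: (a %| y)%N by rewrite -(Gauss_dvdl _ cab) -h dvdn_mull.
  move=> /dvdnP[q qE]; have ya := nddot_ltn b a s a0.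
  have y0 : y = 0%N by move: yn ya; rewrite qE; case: q {qE} => //; nia.
  by move: h; rewrite y0 mul0n => /eqP; rewrite muln_eq0; lia.
Qed.

Lemma lcm_moduli_gt0 (L m : nat) (G : 'I_L -> nat) :
  (0 < m)%N -> (forall k, (0 < G k)%N) -> (0 < lcm_moduli m G)%N.
Proof.
move=> m0 G0; rewrite /lcm_moduli; apply: (big_ind (fun n => 0 < n)%N) => // [x y|k _].
  by rewrite lcmn_gt0 => -> ->.
by rewrite muln_gt0 m0 G0.
Qed.

Lemma dvdn_lcm_moduli (L m : nat) (G : 'I_L -> nat) (k : 'I_L) :
  (m * G k %| lcm_moduli m G)%N.
Proof. exact: (biglcmn_sup k). Qed.

Lemma group_difference (L m : nat) (G : 'I_L -> nat) (N N' : nat) :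
  (0 < L)%N -> (0 < m)%N -> (forall k, (0 < G k)%N) ->
  (forall k, 2 * `|(N %% (m * G k))%N%:Z - (N' %% (m * G k))%N%:Z| < m%:Z) ->
  exists A e : int,
  [/\ N%:Z - N'%:Z = A * (lcm_moduli m G)%:Z + e,
      forall k, e = (N %% (m * G k))%N%:Z - (N' %% (m * G k))%N%:Z &
      forall k, (N %/ (m * G k))%N%:Z - (N' %/ (m * G k))%N%:Z =
                A * (lcm_moduli m G %/ (m * G k))%N%:Z].
Proof.
move=> L0 m0 G0 small.
pose E k : int := (N %% (m * G k))%N%:Z - (N' %% (m * G k))%N%:Z.
pose Q k : int := (N %/ (m * G k))%N%:Z - (N' %/ (m * G k))%N%:Z.
have QE k : N%:Z - N'%:Z = Q k * (m * G k)%N%:Z + E k.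
  by rewrite {1}(divn_eq N (m * G k)) {1}(divn_eq N' (m * G k)) /Q /E; lia.
(* Both are congruent to [N - N'] modulo [m], and two numbers below [m / 2] in absolute value differ
   by less than [m]. *)
have EE k l : E k = E l.
  have: E k - E l = (Q l * (G l)%:Z - Q k * (G k)%:Z) * m%:Z.
    by have := QE k; rewrite (QE l) !PoszM; nia.
  move: (small k) (small l); rewrite -/(E k) -/(E l).
  move: (_ - Q k * _) (E k) (E l) => z u v su sv uv.
  have zm : `|z * m%:Z| < m%:Z by rewrite -uv; lia.
  suff z0 : z = 0 by apply/eqP; rewrite -subr_eq0 uv z0 mul0r.
  by move: zm; rewrite normrM; nia.
pose k0 := Ordinal L0.
(* Subtracting the common error leaves a multiple of every modulus, hence of their lcm. *)
have : ((lcm_moduli m G)%:Z %| N%:Z - N'%:Z - E k0)%Z.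
  rewrite dvdzE; apply/dvdn_biglcmP => k _; rewrite -[(m * G k)%N]/(`|(m * G k)%N%:Z|%N).
  by rewrite -dvdzE (EE k0 k) (QE k) addrK dvdz_mull.
move=> /dvdzP[A AE]; exists A, (E k0); split=> [|k|k]; first by rewrite -AE subrK.
  exact: EE.
have mk0 : (m * G k)%N%:Z != 0 by rewrite eqz_nat muln_eq0; have := G0 k; lia.
apply: (mulIf mk0); rewrite -mulrA -PoszM divnK ?dvdn_lcm_moduli //.
by rewrite -AE (QE k) (EE k0 k) addrK.
Qed.

(** Comparing quotients by one modulus keeps the error term out; bounding [N - N'] directly would
    only give [n + 1]. *)
Lemma group_difference_bound (L m n : nat) (G : 'I_L -> nat) (N N' : nat) (A : int) :
  (0 < L)%N -> (0 < m)%N -> (forall k, (0 < G k)%N) ->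
  (N < lcm_moduli m G * (1 + n))%N -> (N' < lcm_moduli m G * (1 + n))%N ->
  (forall k, (N %/ (m * G k))%N%:Z - (N' %/ (m * G k))%N%:Z =
             A * (lcm_moduli m G %/ (m * G k))%N%:Z) ->
  (`|A| <= n)%N.
Proof.
move=> L0 m0 G0 ltN ltN' /(_ (Ordinal L0)).
set M := (m * _)%N; have M0 : (0 < M)%N by rewrite muln_gt0 m0 G0.
have hd : (M %| lcm_moduli m G)%N by exact: dvdn_lcm_moduli.
set q := (lcm_moduli m G %/ M)%N.
have qE : (lcm_moduli m G = q * M)%N by rewrite divnK.
have bnd P : (P < lcm_moduli m G * (1 + n))%N -> (P %/ M < q * (1 + n))%N.
  by rewrite qE mulnAC ltn_divLR.
move: (bnd _ ltN) (bnd _ ltN') => hN hN' QA.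
have : (`|A| * `|q%:Z| < q * (1 + n))%N.
  rewrite -abszM -QA; move: (_ %/ M)%N (_ %/ M)%N (q * _)%N hN hN'; lia.
by rewrite mulnC ltn_mul2l => /andP[_]; lia.
Qed.

(** Boolean, so that candidates can be searched with [pick]. *)
Definition compatible (R : realFieldType) (L m : nat) (G : 'I_L -> nat)
    (tau : R) (r : 'I_L -> int) (N : nat) : bool :=
  [forall k, `|r k - (N %% (m * G k))%N%:Z|%:~R <= tau].

Lemma compatible_remainder_diff (R : realFieldType) (L m : nat) (G : 'I_L -> nat)
    (tau : R) (r : 'I_L -> int) (N N' : nat) (k : 'I_L) :
  compatible R L m G tau r N -> compatible R L m G tau r N' ->
  `|(N %% (m * G k))%N%:Z - (N' %% (m * G k))%N%:Z|%:~R <= 2 * tau.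
Proof.
move=> /forallP/(_ k) h /forallP/(_ k) h'.
have : `|(N %% (m * G k))%N%:Z - (N' %% (m * G k))%N%:Z| <=
  `|r k - (N %% (m * G k))%N%:Z| + `|r k - (N' %% (m * G k))%N%:Z| by lia.
by rewrite -(ler_int R) intrD; lra.
Qed.

Lemma compatible_difference (R : realFieldType) (L m : nat) (G : 'I_L -> nat)
    (tau : R) (r : 'I_L -> int) (N N' : nat) :
  (0 < L)%N -> (0 < m)%N -> (forall k, (0 < G k)%N) -> tau < m%:R / 4 ->
  compatible R L m G tau r N -> compatible R L m G tau r N' ->
  exists A e : int,
  [/\ N%:Z - N'%:Z = A * (lcm_moduli m G)%:Z + e,
      `|e|%:~R <= 2 * tau &
      forall k, (N %/ (m * G k))%N%:Z - (N' %/ (m * G k))%N%:Z =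
                A * (lcm_moduli m G %/ (m * G k))%N%:Z].
Proof.
move=> L0 m0 G0 tm c c'.
have d k := compatible_remainder_diff _ _ _ _ _ _ _ _ k c c'.
have [|A [e [AE eE QE]]] := group_difference L m G N N' L0 m0 G0.
  (* Twice the remainder difference is at most [4 * tau < m], which is where the constant 1/4 comes
     from. *)
  by move=> k; rewrite -(ltr_int R) intrM -pmulrn; have := d k; lra.
by exists A, e; split=> //; rewrite (eE (Ordinal L0)).
Qed.

Lemma norm_diff_lt (R : realFieldType) (e1 e2 : int) (t1 t2 : R) (c : nat) :
  `|e1|%:~R <= 2 * t1 -> `|e2|%:~R <= 2 * t2 -> t1 + t2 < c%:R / 2 ->
  `|e2 - e1| < c%:Z.
Proof.
move=> h1 h2 h; have := ler_normB e2 e1.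
by rewrite -(ler_int R) -(ltr_int R) intrD -pmulrn; lra.
Qed.

(** Equating the two expressions of [D] gives [x * a - y * b = f - e]; dividing by the gcd leaves a
    combination of coprime numbers smaller than [s]. *)
Lemma gcd_difference_eq0 (a b s : nat) (D x y e f : int) :
  (0 < a)%N -> (a < b)%N -> (s <= a %/ gcdn a b)%N ->
  D = x * a%:Z + e -> D = y * b%:Z + f -> `|f - e| < (gcdn a b * s)%N%:Z ->
  (`|x| <= nddot (a %/ gcdn a b) (b %/ gcdn a b) s)%N ->
  (`|y| <= nddot (b %/ gcdn a b) (a %/ gcdn a b) s)%N -> x = 0 /\ y = 0.
Proof.
move=> a0 ab; have g0 : (0 < gcdn a b)%N by rewrite gcdn_gt0 a0.
have Ea : (a = a %/ gcdn a b * gcdn a b)%N by rewrite divnK ?dvdn_gcdl.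
have Eb : (b = b %/ gcdn a b * gcdn a b)%N by rewrite divnK ?dvdn_gcdr.
have cop : coprime (a %/ gcdn a b) (b %/ gcdn a b).
  by rewrite /coprime -(eqn_pmul2r g0) muln_gcdl -Ea -Eb mul1n.
move: (gcdn a b) (a %/ _)%N (b %/ _)%N g0 Ea Eb cop => g a' b' g0 Ea Eb cop.
move: a0 ab; rewrite {a}Ea {b}Eb muln_gt0 ltn_pmul2r // => /andP[a0 _] ab sa Dx Dy h hx hy.
apply: (small_combination_eq0 a' b' s x y) => //; first exact: leq_trans sa (ltnW ab).
have g0' : 0 < g%:Z :> int by [].
rewrite -(ltr_pM2r g0') -{1}(gtr0_norm g0') -normrM -PoszM (mulnC s).
suff -> : (x * a'%:Z - y * b'%:Z) * g%:Z = f - e by [].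
by move: Dx; rewrite Dy !PoszM; lia.
Qed.

Theorem theorem3 (R : realFieldType)
  (L1 L2 : nat) (m1 m2 : nat) (G1 : 'I_L1 -> nat) (G2 : 'I_L2 -> nat)
  (hL1 : (1 <= L1)%N) (hL2 : (1 <= L2)%N)
  (hm1 : (1 <= m1)%N) (hm2 : (1 <= m2)%N)
  (hG1 : forall k, (1 <= G1 k)%N) (hG2 : forall k, (1 <= G2 k)%N)
  (hcop1 : forall k k', k != k' -> coprime (G1 k) (G1 k'))
  (hcop2 : forall k k', k != k' -> coprime (G2 k) (G2 k'))
  (heta : (lcm_moduli m1 G1 < lcm_moduli m2 G2)%N)
  (hGam1 : (1 < lcm_moduli m1 G1 %/ gcdn (lcm_moduli m1 G1) (lcm_moduli m2 G2))%N)
  (K : nat)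
  (hK1 : (1 < sigma (lcm_moduli m1 G1 %/ gcdn (lcm_moduli m1 G1) (lcm_moduli m2 G2))
                    (lcm_moduli m2 G2 %/ gcdn (lcm_moduli m1 G1) (lcm_moduli m2 G2)) K)%N)
  (hK2 : sigma (lcm_moduli m1 G1 %/ gcdn (lcm_moduli m1 G1) (lcm_moduli m2 G2))
               (lcm_moduli m2 G2 %/ gcdn (lcm_moduli m1 G1) (lcm_moduli m2 G2)) K.+1 = 1%N)
  (j : nat) (hj : (1 <= j <= K.+1)%N)
  (tau1 tau2 : R) (ht1 : 0 <= tau1) (ht2 : 0 <= tau2)
  (ht1m : tau1 < m1%:R / 4) (ht2m : tau2 < m2%:R / 4)
  (ht12 : tau1 + tau2 <
     (gcdn (lcm_moduli m1 G1) (lcm_moduli m2 G2) *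
      sigma (lcm_moduli m1 G1 %/ gcdn (lcm_moduli m1 G1) (lcm_moduli m2 G2))
            (lcm_moduli m2 G2 %/ gcdn (lcm_moduli m1 G1) (lcm_moduli m2 G2)) j)%N%:R / 2) :
  let eta1 := lcm_moduli m1 G1 in
  let eta2 := lcm_moduli m2 G2 in
  let mg := gcdn eta1 eta2 in
  let Gam1 := (eta1 %/ mg)%N in
  let Gam2 := (eta2 %/ mg)%N in
  let sj := sigma Gam1 Gam2 j in
  let X := minn (eta2 * (1 + nddot Gam2 Gam1 sj)) (eta1 * (1 + nddot Gam1 Gam2 sj)) in
  exists Phi : {ffun 'I_L1 -> int} * {ffun 'I_L2 -> int} ->
               {ffun 'I_L1 -> int} * {ffun 'I_L2 -> int},
    forall N : nat, (N < X)%N ->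
    forall (r1 : {ffun 'I_L1 -> int}) (r2 : {ffun 'I_L2 -> int}),
      (forall k, 0 <= r1 k < (m1 * G1 k)%N%:Z /\
                 (`|r1 k - (N %% (m1 * G1 k))%N%:Z|)%:~R <= tau1) ->
      (forall k, 0 <= r2 k < (m2 * G2 k)%N%:Z /\
                 (`|r2 k - (N %% (m2 * G2 k))%N%:Z|)%:~R <= tau2) ->
      Phi (r1, r2) = ([ffun k => (N %/ (m1 * G1 k))%N%:Z],
                      [ffun k => (N %/ (m2 * G2 k))%N%:Z]).
Proof.
move=> eta1 eta2 mg Gam1 Gam2 sj X.
pose fold (N : nat) : {ffun 'I_L1 -> int} * {ffun 'I_L2 -> int} :=
  ([ffun k => (N %/ (m1 * G1 k))%N%:Z], [ffun k => (N %/ (m2 * G2 k))%N%:Z]).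
pose ok (r : {ffun 'I_L1 -> int} * {ffun 'I_L2 -> int}) (N : nat) :=
  compatible R L1 m1 G1 tau1 r.1 N && compatible R L2 m2 G2 tau2 r.2 N.
have uniq r N N' : (N < X)%N -> (N' < X)%N -> ok r N -> ok r N' -> fold N = fold N'.
  (* Each argument of the minimum in [X] bounds the multiplier of one group: [N1] serves for [A1]
     and [N2] for [A2]. *)
  rewrite !leq_min => /andP[N2 N1] /andP[N2' N1'] /andP[c1 c2] /andP[c1' c2'].
  have [A1 [e1 [AE1 le1 Q1]]] := compatible_difference _ _ _ _ _ _ _ _ hL1 hm1 hG1 ht1m c1 c1'.
  have [A2 [e2 [AE2 le2 Q2]]] := compatible_difference _ _ _ _ _ _ _ _ hL2 hm2 hG2 ht2m c2 c2'.
  have b1 := group_difference_bound _ _ _ _ _ _ _ hL1 hm1 hG1 N1 N1' Q1.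
  have b2 := group_difference_bound _ _ _ _ _ _ _ hL2 hm2 hG2 N2 N2' Q2.
  have err := norm_diff_lt _ _ _ _ _ _ le1 le2 ht12.
  have eta1_gt0 : (0 < eta1)%N by apply: lcm_moduli_gt0.
  have sG1 : (sj <= Gam1)%N by apply: sigma_leq (ltnW hGam1).
  have [z1 z2] := gcd_difference_eq0 _ _ _ _ _ _ _ _ eta1_gt0 heta sG1 AE1 AE2 err b1 b2.
  rewrite /fold; congr pair; apply/ffunP => k; rewrite !ffunE; apply/eqP; rewrite -subr_eq0.
    by rewrite Q1 z1 mul0r.
  by rewrite Q2 z2 mul0r.
(* The default [r] is returned only for tuples compatible with no number below [X]. *)
exists (fun r => if [pick N : 'I_X | ok r N] is Some N then fold N else r).
move=> N NX r1 r2 h1 h2; rewrite -/(fold N).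
have okN : ok (r1, r2) N.
  by apply/andP; split; apply/forallP => k; [case: (h1 k) | case: (h2 k)].
(* The search may find some [N'] other than [N], but uniqueness gives it the same folding
   integers. *)
case: pickP => [N' okN'|/(_ (Ordinal NX))]; last by rewrite /= okN.
exact: uniq okN' okN.
Qed.
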